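(* Let $\mathcal{G}=(\mathcal{V},\mathcal{E})$ be a directed graph with vertex set $\{1,\dots,N_s\}$, and for each $r\in\{1,\dots,N_s\}$ let the network $P_r$ be given by $$x^N_{k+1}=A_rx^N_k+B_{r,1}w_k+B_{r,2}u_k,\quad z_k=C_{r,1}x^N_k+D_{r,11}w_k+D_{r,12}u_k,\quad y_k=C_{r,2}x^N_k+D_{r,21}w_k+D_{r,22}u_k,$$ with $w_k,z_k\in\mathbb{R}^c$. Assume that there exist matrices $\{\Pi_r,\Gamma_r\}_{r=1}^{N_s}$ solving the regulator equation $$\begin{pmatrix}A_r&B_{r,2}\\ C_{r,1}&D_{r,12}\end{pmatrix}\begin{pmatrix}\Pi_r\\ \Gamma_r\end{pmatrix}=\begin{pmatrix}\Pi_{r'}\\ I_c\end{pmatrix}\qquad\text{for all }(r,r')\in\mathcal{E},$$ with $C_{r,1}\Pi_r+D_{r,12}\Gamma_r=I_c$ for every $r\in\{1,\dots,N_s\}$, and set $\Phi_r:=C_{r,2}\Pi_r+D_{r,22}\Gamma_r$. For each $r$, let $R_r$ be an arbitrary subcontroller with matrices $A_{r,c},B_{r,c},C_{r,c1},C_{r,c2},D_{r,c1},D_{r,c2}$, and let $K_r=Q_r\star R_r$ be the controller with state $(\omega,\tilde\xi)$, input $y$, output $u$ and matrices $$A^K_r=\begin{pmatrix}I_c+D_{r,c1}\Phi_r&C_{r,c1}\\ B_{r,c}\Phi_r&A_{r,c}\end{pmatrix},\quad B^K_r=\begin{pmatrix}D_{r,c1}\\ B_{r,c}\end{pmatrix},\quad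 C^K_r=\begin{pmatrix}-\Gamma_r+D_{r,c2}\Phi_r&C_{r,c2}\end{pmatrix},\quad D^K_r=D_{r,c2},$$ where the feedback interconnection $P_r\star K_r$ is well-posed, i.e. $I-D_{r,c2}D_{r,22}$ is invertible, for each $r$. Let $\mathcal{A}_r$ and $\mathcal{C}_r$ be the state matrix and the output matrix (to $z$) of the closed loop $P_r\star Q_r\star R_r=P_r\star K_r$. Then there exist matrices $\{\Theta_r\}_{r=1}^{N_s}$ such that $$\mathcal{A}_r\Theta_r-\Theta_{r'}=0\ \text{ for all }(r,r')\in\mathcal{E},\qquad \mathcal{C}_r\Theta_r=I_c\ \text{ for all }r\in\{1,\dots,N_s\}.$$
   Context: All matrices are real of compatible sizes; $\Pi_r$ and $\Gamma_r$ have $c$ columns. The internal model $Q_r$ (state $\omega\in\mathbb{R}^c$) is $\omega_{k+1}=\omega_k+\tilde u_{1,k}$, $u_k=-\Gamma_r\omega_k+\tilde u_{2,k}$, $\tilde y_k=\Phi_r\omega_k+y_k$. The subcontroller $R_r$ (state $\tilde\xi$) is $\tilde\xi_{k+1}=A_{r,c}\tilde\xi_k+B_{r,c}\tilde y_k$, $\tilde u_{i,k}=C_{r,ci}\tilde\xi_k+D_{r,ci}\tilde y_k$ for $i=1,2$. The star product $P_r\star K_r$ of $P_r$ with a controller $\xi_{k+1}=A^K_r\xi_k+B^K_ry_k$, $u_k=C^K_r\xi_k+D^K_ry_k$ is the feedback interconnection along $u,y$, with input $w$, output $z$ and state $(x^N,\xi)$. With $E_r:=(I-D^K_rD_{r,22})^{-1}$,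 its state and output matrices are $$\mathcal{A}_r=\begin{pmatrix}A_r+B_{r,2}E_rD^K_rC_{r,2}&B_{r,2}E_rC^K_r\\ B^K_r(C_{r,2}+D_{r,22}E_rD^K_rC_{r,2})&A^K_r+B^K_rD_{r,22}E_rC^K_r\end{pmatrix},\qquad \mathcal{C}_r=\begin{pmatrix}C_{r,1}+D_{r,12}E_rD^K_rC_{r,2}&D_{r,12}E_rC^K_r\end{pmatrix}.$$ *)

(* Defs.v *)
From mathcomp Require Import all_boot all_order all_algebra.
From mathcomp Require Import reals.

Set Implicit Arguments.
Unset Strict Implicit.
Unset Printing Implicit Defensive.

Import GRing.Theory.
Local Open Scope ring_scope.

(* Dimensions: n for the network state, m for u, p for y, c for w and z. *)
Record network (R : realType) (n m p c : nat) := Network {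
  net_A   : 'M[R]_n;
  net_B1  : 'M[R]_(n, c);
  net_B2  : 'M[R]_(n, m);
  net_C1  : 'M[R]_(c, n);
  net_D11 : 'M[R]_(c, c);
  net_D12 : 'M[R]_(c, m);
  net_C2  : 'M[R]_(p, n);
  net_D21 : 'M[R]_(p, c);
  net_D22 : 'M[R]_(p, m)
}.

Record controller (R : realType) (s m p : nat) := Controller {
  ctl_A : 'M[R]_s;
  ctl_B : 'M[R]_(s, p);
  ctl_C : 'M[R]_(m, s);
  ctl_D : 'M[R]_(m, p)
}.

(* Input u~1 of the internal model has dimension c, u~2 has dimension m, and
   y~ has dimension p; l is the dimension of the state xi~. *)
Record subcontroller (R : realType) (l m p c : nat) := Subcontroller {
  sub_A  : 'M[R]_l;
  sub_B  : 'M[R]_(l, p);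
  sub_C1 : 'M[R]_(c, l);
  sub_C2 : 'M[R]_(m, l);
  sub_D1 : 'M[R]_(c, p);
  sub_D2 : 'M[R]_(m, p)
}.

Section StarProduct.
Variables (R : realType) (n m p c s : nat).
Variables (P : network R n m p c) (K : controller R s m p).

Definition loop_mx : 'M[R]_m := 1%:M - ctl_D K *m net_D22 P.

Definition well_posed : Prop := loop_mx \in unitmx.

Definition star_E : 'M[R]_m := invmx loop_mx.

Definition star_A : 'M[R]_(n + s) :=
  block_mx
    (net_A P + net_B2 P *m star_E *m ctl_D K *m net_C2 P)
    (net_B2 P *m star_E *m ctl_C K)
    (ctl_B K *m (net_C2 P + net_D22 P *m star_E *m ctl_D K *m net_C2 P))
    (ctl_A K + ctl_B K *m net_D22 P *m star_E *m ctl_C K).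

Definition star_C : 'M[R]_(c, n + s) :=
  row_mx
    (net_C1 P + net_D12 P *m star_E *m ctl_D K *m net_C2 P)
    (net_D12 P *m star_E *m ctl_C K).

End StarProduct.

Section InternalModel.
Variables (R : realType) (n m p c l : nat).
Variables (P : network R n m p c) (Pi : 'M[R]_(n, c)) (Gamma : 'M[R]_(m, c)).

Definition Phi : 'M[R]_(p, c) := net_C2 P *m Pi + net_D22 P *m Gamma.

(* K = Q * R, where Q is the internal model
     omega' = omega + u~1,  u = - Gamma omega + u~2,  y~ = Phi omega + y;
   the state is (omega, xi~). *)
Definition internal_model_controller (S : subcontroller R l m p c) :
    controller R (c + l) m p :=
  Controller
    (block_mx (1%:M + sub_D1 S *m Phi) (sub_C1 S)
              (sub_B S *m Phi)         (sub_A S))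
    (col_mx (sub_D1 S) (sub_B S))
    (row_mx (- Gamma + sub_D2 S *m Phi) (sub_C2 S))
    (sub_D2 S).

End InternalModel.

(* Main.v *)
Require Import Defs.
From mathcomp Require Import all_boot all_order all_algebra.
From mathcomp Require Import reals.

Local Open Scope ring_scope.

Import GRing.Theory.
Set Implicit Arguments.

(* The regulator solution (Pi, Gamma) is a trajectory of the network along which
   u = Gamma and y = Phi. The internal model reproduces it from the state
   omega = - I, xi~ = 0: there y~ = - Phi + y vanishes, so the subcontroller
   stays at rest, omega is constant and u = Gamma. Hence
   Theta_r := (Pi_r, - I, 0) works for every subcontroller. *)

Section StarProductTrajectory.
Variables (R : realType) (n m p c s : nat).
Variables (P : network R n m p c) (K : controller R s m p).
Variables (X : 'M[R]_(n, c)) (Xi : 'M[R]_(s, c)) (U : 'M[R]_(m, c)).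
Hypothesis wp : well_posed P K.
(* U is the controller output for the measurement C2 X + D22 U. *)
Hypothesis loopU :
  ctl_C K *m Xi + ctl_D K *m (net_C2 P *m X + net_D22 P *m U) = U.

(** Moving the [net_D22 P] term of [loopU] to the left gives [loop_mx P K *m U] = D C2 X + C Xi, and
    well-posedness inverts [loop_mx]. *)
Lemma star_E_solve :
  star_E P K *m (ctl_D K *m (net_C2 P *m X)) + star_E P K *m (ctl_C K *m Xi)
  = U.
Proof.
rewrite -mulmxDr; have -> : ctl_D K *m (net_C2 P *m X) + ctl_C K *m Xi
    = loop_mx P K *m U.
  by rewrite /loop_mx mulmxBl mul1mx -{1}loopU mulmxDr addrA -mulmxA addrK addrC.
exact: mulKmx.
Qed.

Lemma star_A_mul_col_mx :
  star_A P K *m col_mx X Xi =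
  col_mx (net_A P *m X + net_B2 P *m U)
    (ctl_A K *m Xi + ctl_B K *m (net_C2 P *m X + net_D22 P *m U)).
Proof.
(* [U] is expanded on the right, after which both block rows agree by distributivity and
   associativity. *)
rewrite /star_A mul_block_col -star_E_solve; congr col_mx.
  by rewrite mulmxDl !mulmxDr -!mulmxA addrA.
by rewrite !(mulmxDl, mulmxDr) -!mulmxA [RHS]addrC -!addrA; do 2!congr (_ + _);
  rewrite addrC.
Qed.

Lemma star_C_mul_col_mx :
  star_C P K *m col_mx X Xi = net_C1 P *m X + net_D12 P *m U.
Proof.
by rewrite /star_C mul_row_col -star_E_solve mulmxDl !mulmxDr -!mulmxA addrA.
Qed.

End StarProductTrajectory.

Section InternalModelTrajectory.
Variables (R : realType) (n m p c l : nat).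
Variables (P : network R n m p c) (Pi : 'M[R]_(n, c)) (Gamma : 'M[R]_(m, c)).
Variable S : subcontroller R l m p c.
Let K := internal_model_controller P Pi Gamma S.

Lemma internal_model_output :
  ctl_C K *m col_mx (- 1%:M) 0 + ctl_D K *m Phi P Pi Gamma = Gamma.
Proof.
by rewrite /= mul_row_col mulmx0 addr0 mulmxN mulmx1 opprD opprK subrK.
Qed.

(** The terms through [sub_D1 S] and [sub_B S] cancel. The fixed state is the same at every vertex,
    so it survives a switch of controller along an edge. *)
Lemma internal_model_state :
  ctl_A K *m col_mx (- 1%:M) 0 + ctl_B K *m Phi P Pi Gamma
  = col_mx (- 1%:M) 0.
Proof.
rewrite /= mul_block_col !mulmx0 !addr0 !mulmxN !mulmx1 mul_col_mx add_col_mx.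
by rewrite opprD subrK addNr.
Qed.

End InternalModelTrajectory.

Unset Implicit Arguments.

Theorem theorem5p2 (R : realType) (Ns : nat) (edge : rel 'I_Ns)
    (n c l : nat) (m p : 'I_Ns -> nat)
    (P : forall r : 'I_Ns, network R n (m r) (p r) c)
    (Pi : 'I_Ns -> 'M[R]_(n, c))
    (Gamma : forall r : 'I_Ns, 'M[R]_(m r, c))
    (regulator : forall r r' : 'I_Ns, edge r r' ->
       block_mx (net_A (P r)) (net_B2 (P r))
                (net_C1 (P r)) (net_D12 (P r))
         *m col_mx (Pi r) (Gamma r)
       = col_mx (Pi r') 1%:M)
    (regulator_output : forall r : 'I_Ns,
       net_C1 (P r) *m Pi r + net_D12 (P r) *m Gamma r = 1%:M)
    (S : forall r : 'I_Ns, subcontroller R l (m r) (p r) c)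
    (K := fun r : 'I_Ns =>
       internal_model_controller (P r) (Pi r) (Gamma r) (S r))
    (wp : forall r : 'I_Ns, well_posed (P r) (K r)) :
  exists Theta : 'I_Ns -> 'M[R]_(n + (c + l), c),
    (forall r r' : 'I_Ns, edge r r' ->
       star_A (P r) (K r) *m Theta r - Theta r' = 0)
    /\ (forall r : 'I_Ns, star_C (P r) (K r) *m Theta r = 1%:M).
Proof.
(* Unfolding [Phi] turns this into [loopU] with [X] = [Pi r] and [U] = [Gamma r]. *)
have loopG r := internal_model_output (P r) (Pi r) (Gamma r) (S r).
exists (fun r => col_mx (Pi r) (col_mx (- 1%:M) 0)); split=> [r r' err' | r].
- have := regulator r r' err'; rewrite mul_block_col => /eq_col_mx[APi _].
  rewrite (star_A_mul_col_mx (wp r) (loopG r)) APi.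
  by rewrite internal_model_state subrr.
(* What remains is [regulator_output r], which also covers vertices without outgoing edges. *)
- by rewrite (star_C_mul_col_mx (wp r) (loopG r)).
Qed.
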